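(* Let $\mathcal H$ be a real Hilbert space, let $\Phi:\mathcal H\to\mathbb R\cup\{+\infty\}$ be a convex lower semicontinuous proper function, and let $\Psi:\mathcal H\to\mathbb R$ be a convex continuously differentiable function whose gradient is $L$-Lipschitz continuous ($L>0$). Suppose that $\operatorname{argmin}(\Phi+\Psi)$ is nonempty. Let $\alpha>3$, $0<s<\frac1L$, and let $(g_k)_{k\ge0}$ be a sequence in $\mathcal H$ with $\sum_{k\in\mathbb N}k\|g_k\|<+\infty$. Let $(x_k)$ be a sequence generated, from initial points $x_{-1},x_0\in\mathcal H$, by the algorithm, for $k\ge0$, $$y_k=x_k+\frac{k-1}{k+\alpha-1}(x_k-x_{k-1}),\qquad x_{k+1}=\operatorname{prox}_{s\Phi}\bigl(y_k-s(\nabla\Psi(y_k)-g_k)\bigr).$$ Then: i) $\sum_{k\ge1}k\bigl((\Phi+\Psi)(x_k)-\inf(\Phi+\Psi)\bigr)<+\infty$; ii) $\sum_{k\ge1}k\|x_{k+1}-x_k\|^2<+\infty$; iii) $(x_k)$ converges weakly in $\mathcal H$, as $k\to+\infty$, to some $x^*\in\operatorname{argmin}(\Phi+\Psi)$.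
   Context: For $\gamma>0$ and a convex lower semicontinuous proper function $\Phi$, the proximal operator is $\operatorname{prox}_{\gamma\Phi}(x)=\operatorname{argmin}_{\xi\in\mathcal H}\left\{\Phi(\xi)+\frac1{2\gamma}\|\xi-x\|^2\right\}=(I+\gamma\,\partial\Phi)^{-1}(x)$, where $\partial\Phi$ is the convex subdifferential. *)

(* Defs.v *)
From HB Require Import structures.
From mathcomp Require Import all_boot all_order all_algebra.
From mathcomp Require Import sesquilinear.
From mathcomp Require Import all_classical all_reals all_analysis.

Set Implicit Arguments.
Unset Strict Implicit.
Unset Printing Implicit Defensive.

Import Order.TTheory GRing.Theory Num.Theory.
Import numFieldNormedType.Exports.

Local Open Scope classical_set_scope.
Local Open Scope convex_scope.
Local Open Scope ring_scope.

(* A real Hilbert space is a complete normed module [H] over a [realType]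
   together with a positive definite symmetric bilinear form
   [dot : {dot H for idfun}] that induces the norm of [H]. *)
Definition induces_norm (R : realType) (H : completeNormedModType R)
    (dot : {dot H for idfun}) : Prop :=
  forall u : H, `|u| = Num.sqrt (dot u u).

Section extended_real_valued.
Context (R : realType) (H : completeNormedModType R).
Implicit Types (f : H -> \bar R).
Local Open Scope ereal_scope.

Definition proper_function f : Prop :=
  (forall x, f x != -oo) /\ (exists x, f x < +oo).

(* Only meant for functions that do not take the value -oo; at the end points
   [t = 0] and [t = 1] the library's convention [0 * +oo = 0] makes the
   inequality trivial. *)
Definition econvex f : Prop :=
  forall (t : {i01 R}) (x y : convex_lmodType H),
    f (x <| t |> y) <= t%:num%:E * f x + (1 - t%:num)%:E * f y.

Definition argmin f : set H := [set x | forall y, f x <= f y].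

(* When [f] is convex, lower semicontinuous and proper and [0 < gamma], the set
   of minimizers is a singleton, and [prox gamma f x] is its element. *)
Definition prox (gamma : R) f (x : H) : H :=
  get (argmin (fun xi => f xi + ((2 * gamma)^-1 * `|xi - x| ^+ 2)%:E)).

End extended_real_valued.

(* The Riesz representative of the Frechet differential; meaningful where [f]
   is differentiable. *)
Definition gradient (R : realType) (H : completeNormedModType R)
    (dot : {dot H for idfun}) (f : H -> R) (x : H) : H :=
  get [set v : H | forall h : H, 'd f x h = dot v h].

Definition weakly_cvg (R : realType) (H : completeNormedModType R)
    (u : nat -> H) (l : H) : Prop :=
  forall phi : {linear H -> R^o}, continuous phi ->
    phi (u n) @[n --> \oo] --> phi l.

(* x_(k-1), for the sequence (x_k) indexed from -1 whose term of index -1 is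
   [xm1] and whose other terms are given by [x]. *)
Definition prev_term (T : Type) (xm1 : T) (x : nat -> T) (k : nat) : T :=
  if k is j.+1 then x j else xm1.

(* Main.v *)
(* Let tau_j = j + alpha - 1, W_j = (Phi + Psi)(x_(j+1)) - min and
   V_j = (alpha - 1) (x_j - z) + tau_j (x_(j+1) - x_j).  The forward-backward
   inequality at a convex combination of x_(j+1) and a minimizer z makes
   E_j = 2 s tau_j^2 W_j + |V_j|^2 decrease by a multiple of tau_j W_j
   (this is where alpha > 3 enters), up to a summable perturbation; hence i) and
   the boundedness of (x_j).  The same inequality at x_(j+1) makes
   N_j = tau_j^2 |x_(j+1) - x_j|^2 + 2 s tau_j^2 W_j almost decreasing, hence ii).
   As N_j converges and sum N_j / tau_j is finite, N_j tends to 0, so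
   E_j - (alpha - 1)^2 |x_j - z|^2 tends to 0 and |x_j - z| converges.
   Opial's argument concludes: along ultrafilters weak limits exist by Riesz, they
   are minimizers (compare v with the proximal point of Phi + Psi at v), and
   the convergence of the distances to all minimizers makes them coincide. *)
Require Import Defs.
From HB Require Import structures.
From mathcomp Require Import all_boot all_order all_algebra.
From mathcomp Require Import sesquilinear.
From mathcomp Require Import all_classical all_reals all_analysis.
From mathcomp Require Import ring lra.

Set Implicit Arguments.
Unset Strict Implicit.
Unset Printing Implicit Defensive.

Import Order.TTheory GRing.Theory Num.Theory.
Import numFieldNormedType.Exports.

Local Open Scope classical_set_scope.
Local Open Scope ring_scope.

(** * Inner products *)

Section dot_product.
Context (R : realType) (H : completeNormedModType R) (dot : {dot H for idfun}).
Hypothesis hdot : induces_norm dot.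
Implicit Types u v w h : H.

Lemma dotC u v : dot u v = dot v u.
Proof. by rewrite (hermC dot) expr0 mul1r. Qed.

Lemma dotDl u v w : dot (u + v) w = dot u w + dot v w.
Proof. exact: linearDl. Qed.

Lemma dotDr u v w : dot w (u + v) = dot w u + dot w v.
Proof. exact: linearDr. Qed.

Lemma dotZl k u v : dot (k *: u) v = k * dot u v.
Proof. by rewrite linearZl_LR. Qed.

Lemma dotZr k u v : dot u (k *: v) = k * dot u v.
Proof. by rewrite linearZr_LR. Qed.

Lemma dotNl u v : dot (- u) v = - dot u v.
Proof. exact: linearNl. Qed.

Lemma dotNr u v : dot u (- v) = - dot u v.
Proof. exact: linearNr. Qed.

Lemma dot_ge0 u : 0 <= dot u u.
Proof.
have [->|/neq0_dnorm_gt0/ltW//] := eqVneq u 0.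
by rewrite linear0l.
Qed.

Definition dotE := (dotDl, dotDr, dotZl, dotZr, dotNl, dotNr).

Lemma sqr_normE u : `|u| ^+ 2 = dot u u.
Proof. by rewrite hdot sqr_sqrtr// dot_ge0. Qed.

Lemma dot_eq u v : dot (u - v) (u - v) = 0 -> u = v.
Proof. by move/eqP; rewrite -sqr_normE sqrf_eq0 normr_eq0 subr_eq0 => /eqP. Qed.

(** Cauchy-Schwarz: expand the squared norm of [|v| u - |u| v] and divide by [|u| |v|]. *)
Lemma dot_le u v : dot u v <= `|u| * `|v|.
Proof.
have [->|u0] := eqVneq u 0; first by rewrite linear0l normr0 mul0r.
have [->|v0] := eqVneq v 0; first by rewrite linear0r normr0 mulr0.
have nu : 0 < `|u| by rewrite normr_gt0.
have nv : 0 < `|v| by rewrite normr_gt0.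
have := dot_ge0 (`|v| *: u - `|u| *: v).
rewrite !dotE -!sqr_normE (dotC v u) => h.
have {}h : 0 <= (`|u| * `|v|) * (2 * (`|u| * `|v| - dot u v)).
  by apply: le_trans h _; rewrite le_eqVlt; apply/orP; left; apply/eqP; ring.
by move: h; rewrite pmulr_rge0 ?mulr_gt0// pmulr_rge0// subr_ge0.
Qed.

Lemma normr_dot_le u v : `|dot u v| <= `|u| * `|v|.
Proof.
rewrite ler_norml dot_le andbT -lerN2 opprK -dotNl (le_trans (dot_le _ _))//.
by rewrite normrN.
Qed.

End dot_product.

(** * Convex functions on a normed module *)

Section convexity.
Context (R : realType) (H : completeNormedModType R).
Implicit Types (f : H -> \bar R) (t : R) (x y z : H).

Lemma convex_functionE (f : H -> R) t x y : convex_function [set: H] f ->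
  0 <= t -> t <= 1 -> f (t *: x + (1 - t) *: y) <= t * f x + (1 - t) * f y.
Proof.
move=> cf t0 t1; have := cf (Itv01 t0 t1) x y (in_setT _) (in_setT _).
exact.
Qed.

Lemma econvexE f t x y : econvex f -> 0 <= t -> t <= 1 ->
  (f (t *: x + (1 - t) *: y)%R <= t%:E * f x + (1 - t)%:E * f y)%E.
Proof. by move=> cf t0 t1; have := cf (Itv01 t0 t1) x y; exact. Qed.

Lemma econvexD f (g : H -> R) : econvex f -> convex_function [set: H] g ->
  econvex (fun z => f z + (g z)%:E)%E.
Proof.
move=> cf cg t x y.
have /(leeD (cf t x y)) : ((g (conv t x y))%:E <=
    (t%:num * g x + (1 - t%:num) * g y)%:E)%E.
  by rewrite lee_fin; apply: cg; rewrite in_setT.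
move/le_trans; apply.
rewrite !muleDr ?fin_num_adde_defl// -!EFinM.
by rewrite EFinD addeACA.
Qed.

(** The factor 2 leaves room for two errors of size [d]; working with a real gap also covers the
    value [+oo]. *)
Lemma lte_EFin_gap (r : R) (e : \bar R) : (r%:E < e)%E ->
  exists2 d, 0 < d & ((r + 2 * d)%:E < e)%E.
Proof.
case: e => [e| |]//; last by exists 1; rewrite ?ltry.
rewrite lte_fin => re; exists ((e - r) / 3); first by rewrite divr_gt0 ?subr_gt0.
by rewrite lte_fin; lra.
Qed.

Lemma lower_semicontinuousD f (g : H -> R) :
  lower_semicontinuous f -> continuous g ->
  lower_semicontinuous (fun z => f z + (g z)%:E)%E.
Proof.
move=> lf cg x a; rewrite -lteBlDr// => /lte_EFin_gap[d d0 ltf].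
have [V xV Vf] := lf _ _ ltf.
exists (V `&` [set z | `|g x - g z| < d]).
  by apply: filterI => //; exact: cvgr_dist_lt (cg x) _ d0.
move=> z [/Vf fz /=]; rewrite ltr_norml => /andP[_ gz].
rewrite -lteBlDr//; apply: lt_trans fz; rewrite lte_fin; lra.
Qed.

End convexity.

(** * Strongly convex minimization *)

Section minimization.
Context (R : realType) (H : completeNormedModType R) (dot : {dot H for idfun}).
Hypothesis hdot : induces_norm dot.
Implicit Types (f : H -> \bar R).

Lemma parallelogram_midpoint (x u v : H) :
  `|2^-1 *: u + (1 - 2^-1) *: v - x| ^+ 2 =
  2^-1 * `|u - x| ^+ 2 + 2^-1 * `|v - x| ^+ 2 - 4^-1 * `|u - v| ^+ 2.
Proof.
rewrite !(sqr_normE hdot) !dotE (dotC dot v u) (dotC dot x u) (dotC dot x v).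
by field.
Qed.

(* Near-minimizers are close to each other, so minimizing sequences are Cauchy. *)
Lemma strongly_convex_near_min f (c m ra rb : R) (x a b : H) : econvex f ->
  proper_function f ->
  (forall z, m%:E <= f z + (c * `|z - x| ^+ 2)%:E)%E ->
  (f a + (c * `|a - x| ^+ 2)%:E)%E = ra%:E ->
  (f b + (c * `|b - x| ^+ 2)%:E)%E = rb%:E ->
  (c / 4 * `|a - b| ^+ 2 <= (ra + rb) / 2 - m).
Proof.
move=> cf [fNy _] mf fa fb.
have := mf (2^-1 *: a + (1 - 2^-1) *: b).
rewrite parallelogram_midpoint.
have h0 : 0 <= 2^-1 :> R by rewrite invr_ge0.
have h1 : 2^-1 <= 1 :> R by rewrite invf_le1// ler1n.
have := @econvexE _ _ f 2^-1 a b cf h0 h1.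
case: (f a) fa (fNy a) => [fa| |]//= [<-] _.
case: (f b) fb (fNy b) => [fb| |]//= [<-] _.
case: (f (_ + _)) (fNy (2^-1 *: a + (1 - 2^-1) *: b)) => [fm| |]//= _.
by rewrite -!EFinM -!EFinD !lee_fin; lra.
Qed.

(** The direct method in the norm topology: a minimizing sequence is Cauchy by strong convexity, and
    lower semicontinuity passes to its limit. *)
Lemma strongly_convex_min f (c m : R) (x : H) : econvex f ->
  lower_semicontinuous f -> proper_function f -> 0 < c ->
  (forall z, m%:E <= f z + (c * `|z - x| ^+ 2)%:E)%E ->
  argmin (fun z => f z + (c * `|z - x| ^+ 2)%:E)%E !=set0.
Proof.
move=> cf lf pf c0 mf; have [fNy [z0 fz0]] := pf.
pose A := [set r : R | exists z, (f z + (c * `|z - x| ^+ 2)%:E)%E = r%:E].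
have A0 : A !=set0.
  case E : (f z0) fz0 (fNy z0) => [r| |]// _ _.
  by exists (r + c * `|z0 - x| ^+ 2), z0; rewrite E EFinD.
have lA : has_lbound A.
  by exists m => r [z zr]; have := mf z; rewrite zr lee_fin.
have infA z : ((inf A)%:E <= f z + (c * `|z - x| ^+ 2)%:E)%E.
  case E : (f z) (fNy z) => [r| |]// _; last by rewrite addye// leey.
  by rewrite -EFinD lee_fin; apply: (ge_inf lA); exists z; rewrite E EFinD.
have /choice[u uP] (n : nat) : exists z, exists2 r,
    (f z + (c * `|z - x| ^+ 2)%:E)%E = r%:E & r < inf A + n.+1%:R^-1.
  have n0 : 0 < n.+1%:R^-1 :> R by rewrite invr_gt0 ltr0n.
  by have [r [z zr] ltr] := inf_adherent n0 (conj A0 lA); exists z, r.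
have dist_u n p : (n <= p)%N -> `|u n - u p| ^+ 2 <= 4 / c * n.+1%:R^-1.
  move=> np; have [r ur rn] := uP n; have [q uq qp] := uP p.
  have le := strongly_convex_near_min cf pf infA ur uq.
  have pn : p.+1%:R^-1 <= n.+1%:R^-1 :> R.
    by rewrite lef_pV2 ?posrE ?ltr0n// ler_nat.
  rewrite [leRHS]mulrAC ler_pdivlMr// [leLHS]mulrC.
  move: le pn rn qp.
  move: (n.+1%:R^-1) (p.+1%:R^-1) (`|_ - _| ^+ 2) => en ep X.
  lra.
have cauchy_u : cauchy (u @ \oo).
  apply: cauchy_exP => e e0.
  have e1 : 0 < c / 4 * e ^+ 2 by rewrite mulr_gt0 ?divr_gt0 ?exprn_gt0.
  have [N _ NP] := near_infty_natSinv_lt (PosNum e1).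
  exists (u N); exists N => // n /= Nn.
  rewrite -ball_normE /= -(ltr_pXn2r (n := 2)) ?nnegrE// ?(ltW e0)//.
  apply: le_lt_trans (dist_u _ _ Nn) _.
  have := NP N (leqnn N); rewrite /= => h.
  have -> : e ^+ 2 = 4 / c * (c / 4 * e ^+ 2) by field; rewrite gt_eqF.
  by rewrite ltr_pM2l// divr_gt0.
have /cauchy_cvgP/cvg_ex[z uz] := cauchy_u.
have qcvg : c * `|u n - x| ^+ 2 @[n --> \oo] --> c * `|z - x| ^+ 2.
  apply: cvgMr; apply: cvgM; apply: cvg_norm; apply: cvgB => //; exact: cvg_cst.
suff zmin : (f z + (c * `|z - x| ^+ 2)%:E <= (inf A)%:E)%E.
  by exists z => y; exact: le_trans zmin (infA y).
rewrite leNgt; apply/negP => ltz.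
(* If [z] were not optimal, semicontinuity would keep the objective at [u n] above [inf A + d],
   whereas it is below [inf A + n.+1^-1]. *)
have [d d0 fz] : exists2 d, 0 < d & ((inf A - c * `|z - x| ^+ 2 + 2 * d)%:E < f z)%E.
  by apply: lte_EFin_gap; rewrite EFinB lteBlDr.
have [V zV Vf] := lf _ _ fz.
have : \forall n \near \oo, False; last by move=> [N _ /(_ N (leqnn N))].
near=> n.
have [r ur rn] := uP n.
have h1 : ((inf A - c * `|z - x| ^+ 2 + 2 * d)%:E < f (u n))%E.
  by apply: Vf; near: n; exact: uz.
have h2 : n.+1%:R^-1 < d.
  near: n; exact: (near_infty_natSinv_lt (PosNum d0)).
have h3 : `|c * `|z - x| ^+ 2 - c * `|u n - x| ^+ 2| < d.
  by near: n; exact: cvgr_dist_lt qcvg _ d0.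
move: h3; rewrite ltr_norml => /andP[_ h3].
move: h1; case: (f (u n)) ur => [s| |]//= [sr].
rewrite lte_fin; move: rn h2 h3; rewrite -sr.
move: (n.+1%:R^-1) (c * `|z - x| ^+ 2) (c * `|u n - x| ^+ 2) => en qz qu.
lra.
Unshelve. all: by end_near. Qed.

End minimization.

(** * Subgradients, proximal points and the Riesz representation *)

Section first_order.
Context (R : realType) (H : completeNormedModType R).
Implicit Types (f : H -> \bar R).

Lemma ge0_of_small_perturbation (D B : R) :
  (forall t, 0 < t -> t <= 1 -> 0 <= D + t * B) -> 0 <= D.
Proof.
move=> DB; rewrite leNgt; apply/negP => D0.
have BD : 0 < `|B| - D by rewrite subr_gt0 (lt_le_trans D0).
(* This [t] solves [t (|B| - D) = - D], so that [D + t |B| = t D < 0]. *)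
have t0 : 0 < - D / (`|B| - D) by rewrite divr_gt0// oppr_gt0.
have t1 : - D / (`|B| - D) <= 1 by rewrite ler_pdivrMr// mul1r lerDr.
have := DB _ t0 t1; apply/negP; rewrite -ltNge.
have : - D / (`|B| - D) * B <= - D / (`|B| - D) * `|B|.
  by rewrite ler_pM2l// ler_norm.
have -> : - D / (`|B| - D) * `|B| = - D - (- D / (`|B| - D)) * (- D).
  by field; rewrite gt_eqF.
have : 0 < - D / (`|B| - D) * - D by rewrite mulr_gt0// oppr_gt0.
lra.
Qed.

(** Moving from [p] towards [z] by [t] changes the objective by at most [t (f z - f p + A) + t^2 B];
    divide by [t] and let it tend to 0. Only an upper expansion of [q] is required, so the lemma
    serves both squared distances and [Psi]. *)
Lemma first_order_condition f (q : H -> R) (p z : H) (A B : R) :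
  econvex f -> f p \is a fin_num ->
  (forall u, f p + (q p)%:E <= f u + (q u)%:E)%E ->
  (forall t, 0 < t -> t <= 1 ->
     q (t *: z + (1 - t) *: p) <= q p + t * A + t ^+ 2 * B) ->
  (f p <= f z + A%:E)%E.
Proof.
move=> cf fp fmin qle.
have : forall u, f u != -oo%E.
  by move=> u; apply/eqP => fu; have := fmin u; rewrite fu; case: (f p) fp.
move: fmin; case fpE : (f p) fp => [P| |]// _ fmin fNy.
case fzE : (f z) (fNy z) => [Z| |]// _; last by rewrite addye// leey.
rewrite -EFinD lee_fin -subr_ge0.
apply: (@ge0_of_small_perturbation _ B) => t t0 t1.
have := econvexE z p cf (ltW t0) t1.
have := fmin (t *: z + (1 - t) *: p); have := qle t t0 t1.
rewrite fzE fpE.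
case: (f (_ + _)) (fNy (t *: z + (1 - t) *: p)) => [r| |]// _.
rewrite -!EFinM -!EFinD !lee_fin => h1 h2 h3.
rewrite -(pmulr_rge0 _ t0); move: h1 h2 h3.
have -> : t ^+ 2 * B = t * (t * B) by ring.
lra.
Qed.

End first_order.

Section hilbert.
Context (R : realType) (H : completeNormedModType R) (dot : {dot H for idfun}).
Hypothesis hdot : induces_norm dot.
Implicit Types (f : H -> \bar R).

Lemma sqr_norm_conv (c t : R) (x p z : H) :
  c * `|t *: z + (1 - t) *: p - x| ^+ 2 =
  c * `|p - x| ^+ 2 + t * (2 * c * dot (p - x) (z - p)) +
  t ^+ 2 * (c * `|z - p| ^+ 2).
Proof.
rewrite !(sqr_normE hdot) !dotE (dotC dot z p) (dotC dot x p) (dotC dot x z).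
by ring.
Qed.

(** The inequality says that [2 c (x - p)] is a subgradient of [f] at [p]. *)
Lemma argmin_sqr_dist f (c : R) (x p : H) : econvex f -> proper_function f ->
  argmin (fun z => f z + (c * `|z - x| ^+ 2)%:E)%E p ->
  f p \is a fin_num /\
  forall z, (f p <= f z + (2 * c * dot (p - x) (z - p))%:E)%E.
Proof.
move=> cf [fNy [z0 fz0]] pmin.
have fp : f p \is a fin_num.
  have := pmin z0; rewrite /=.
  case: (f p) (fNy p) => [| |]// _.
  by case: (f z0) fz0.
split=> // z.
apply: (first_order_condition (q := fun z => c * `|z - x| ^+ 2)
  (B := c * `|z - p| ^+ 2)) => // t _ _.
by rewrite sqr_norm_conv.
Qed.

(** The resolvent form of [prox]. The lower bound [m] ensures that a minimizer exists, so that [get]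
    returns one. *)
Lemma proxP f (gamma m : R) (x : H) : econvex f -> lower_semicontinuous f ->
  proper_function f -> 0 < gamma ->
  (forall z, m%:E <= f z + ((2 * gamma)^-1 * `|z - x| ^+ 2)%:E)%E ->
  f (prox gamma f x) \is a fin_num /\
  forall z, (f (prox gamma f x) <=
    f z + (gamma^-1 * dot (prox gamma f x - x) (z - prox gamma f x))%:E)%E.
Proof.
move=> cf lf pf g0 fm.
have c0 : 0 < (2 * gamma)^-1 by rewrite invr_gt0 mulr_gt0.
have /getPex/(argmin_sqr_dist cf pf)[fp hp] :=
  strongly_convex_min hdot cf lf pf c0 fm.
split=> // z; have := hp z; congr (_ <= _ + (_ * _)%:E)%E.
by field; rewrite gt_eqF.
Qed.

(* The representative minimizes [|v|^2 / 2 - phi v]. *)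
Lemma riesz (phi : {linear H -> R^o}) : continuous phi ->
  exists v, forall h, phi h = dot v h.
Proof.
move=> cphi; pose f z : \bar R := (- phi z)%:E.
have [C C0 phiC] : exists2 C, 0 < C & forall z, `|phi z| <= C * `|z|.
  have /linear_boundedP/pinfty_ex_gt0[C C0 phiC] :=
    continuous_linear_bounded 0 (cphi 0).
  by exists C.
have cf : econvex f.
  move=> t x y; rewrite /f -!EFinM -EFinD lee_fin.
  have -> : phi (conv t x y) = t%:num * phi x + (1 - t%:num) * phi y.
    by rewrite [LHS]linearD !linearZ.
  lra.
have lf : lower_semicontinuous f.
  have -> : f = (fun z => 0%E + (- phi z)%:E)%E by apply/funext => z; rewrite add0e.
  apply: lower_semicontinuousD => [x a a0|x]; last exact: cvgN (cphi x).
  by exists setT; [exact: filterT|].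
have pf : proper_function f by split=> //; exists 0; rewrite ltry.
(* Completing the square: [- C r + r^2 / 2 >= - C^2 / 2]. *)
have mf z : ((- (C ^+ 2) / 2)%:E <= f z + (2^-1 * `|z - 0| ^+ 2)%:E)%E.
  rewrite subr0 -EFinD lee_fin; have := phiC z; rewrite ler_norml => /andP[_ h].
  have := sqr_ge0 (C - `|z|); rewrite sqrrB; lra.
have c0 : 0 < 2^-1 :> R by rewrite invr_gt0.
have [v /(argmin_sqr_dist cf pf)[_ vP]] := strongly_convex_min hdot cf lf pf c0 mf.
have le h : phi h <= dot v h.
  have := vP (v + h); rewrite -EFinD lee_fin linearD/= subr0.
  by rewrite mulfV// mul1r addrAC subrr add0r; lra.
exists v => h; apply/eqP; rewrite eq_le le/=.
by have := le (- h); rewrite linearN/= dotNr lerN2.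
Qed.

Lemma gradientP (f : H -> R) (x h : H) : differentiable f x ->
  'd f x h = dot (gradient dot f x) h.
Proof.
move=> df; have /riesz/getPex := diff_continuous df.
by rewrite /gradient /=; apply.
Qed.

End hilbert.

(** * The forward-backward inequality *)

Section smooth_convex.
Context (R : realType) (H : completeNormedModType R) (dot : {dot H for idfun}).
Hypothesis hdot : induces_norm dot.
Variables (Psi : H -> R) (L : R).
Hypotheses (Psi_convex : convex_function [set: H] Psi)
  (Psi_diff : forall z, differentiable Psi z)
  (Psi_lip : L.-lipschitz (gradient dot Psi)).

Local Notation grad := (gradient dot Psi).

(** By convexity the difference quotients from [x] towards [y] are at most [Psi y - Psi x]; let the
    step tend to 0 from the right. *)
Lemma gradient_inequality (x y : H) : Psi x + dot (grad x) (y - x) <= Psi y.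
Proof.
rewrite -lerBrDl -gradientP// -deriveE//.
have cvgD : t^-1 * (Psi (t *: (y - x) + x) - Psi x) @[t --> 0^'+] -->
    'D_(y - x) Psi x.
  by apply: cvg_dnbhs_at_right; exact: diff_derivable.
have := cvg_lim (@Rhausdorff R) cvgD => <-.
apply: limr_le; first by apply/cvg_ex; exists ('D_(y - x) Psi x).
near=> t.
have t0 : 0 < t by [].
have t1 : t <= 1 by near: t; exact: nbhs_right_le.
rewrite /= ler_pdivrMl//.
have := convex_functionE y x Psi_convex (ltW t0) t1.
have -> : t *: y + (1 - t) *: x = t *: (y - x) + x.
  by rewrite scalerBr scalerBl scale1r addrA addrAC.
by rewrite mulrBr; lra.
Unshelve. all: by end_near. Qed.

Lemma gradient_lipschitz (x y : H) : `|grad x - grad y| <= L * `|x - y|.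
Proof. exact: (Psi_lip (x := (x, y)) (conj I I)). Qed.

(** The k-th of [n] steps uses the gradient inequality at its far end, where the gradient is within
    [L k d |h|] of [grad x]. Summing [d L k d |h|^2] over k gives the last term. *)
Lemma descent_lemma_step (d : R) (x h : H) (n : nat) : 0 <= d ->
  Psi (x + (n%:R * d) *: h) <= Psi x + n%:R * d * dot (grad x) h +
    d ^+ 2 * (L * `|h| ^+ 2) * (n%:R * (n%:R + 1) / 2).
Proof.
move=> d0; elim: n => [|n IH]; first by rewrite !mul0r scale0r mulr0 !addr0.
set p := x + (n.+1%:R * d) *: h; set p' := x + _ in IH.
have pE : p' - p = (- d) *: h.
  by rewrite /p /p' opprD addrACA subrr add0r -scalerBl -natr1; congr (_ *: _); ring.
have := gradient_inequality p p'; rewrite pE dotZr => step.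
have := gradient_lipschitz p x.
have -> : p - x = (n.+1%:R * d) *: h by rewrite /p addrAC subrr add0r.
rewrite normrZ ger0_norm ?mulr_ge0// => lip.
have := dot_le hdot (grad p - grad x) h; rewrite dotDl dotNl => cs.
have /(le_trans cs) : `|grad p - grad x| * `|h| <= L * (n.+1%:R * d * `|h|) * `|h|.
  by rewrite ler_wpM2r.
move=> /(ler_wpM2l d0); move: IH step.
have -> : n.+1%:R = n%:R + 1 :> R by rewrite natr1.
move: (n%:R) => N; lra.
Qed.

(* Convexity replaces the integral of the derivative along [x, y] by the upper
   Riemann sum on [n.+1] equal pieces, which gives the constant [L / 2] in the
   limit. *)
Lemma descent_lemma (x y : H) :
  Psi y <= Psi x + dot (grad x) (y - x) + L / 2 * `|y - x| ^+ 2.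
Proof.
apply/ler_addgt0Pr => e e0.
have c0 : 0 < `|L / 2 * `|y - x| ^+ 2| + 1 by rewrite ltr_wpDl.
have [n nP] : exists n, n.+1%:R^-1 < e / (`|L / 2 * `|y - x| ^+ 2| + 1).
  have [n _ /(_ n (leqnn n))] := near_infty_natSinv_lt (PosNum (divr_gt0 e0 c0)).
  by exists n.
have := @descent_lemma_step n.+1%:R^-1 x (y - x) n.+1.
have : 0 <= n.+1%:R^-1 :> R by rewrite invr_ge0.
have : n.+1%:R * n.+1%:R^-1 = 1 :> R by rewrite mulfV.
move: nP; rewrite ltr_pdivlMr//.
move: (n.+1%:R : R) => N; move: (N^-1) => d nP Nd d0 /(_ d0).
rewrite Nd scale1r addrCA subrr addr0 mul1r.
have -> : d ^+ 2 * (L * `|y - x| ^+ 2) * (N * (N + 1) / 2) =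
   (N * d) * (N * d) * (L / 2 * `|y - x| ^+ 2) + (N * d) * d * (L / 2 * `|y - x| ^+ 2).
  by field.
rewrite Nd !mul1r.
have := ler_norm (L / 2 * `|y - x| ^+ 2); move: (L / 2 * `|y - x| ^+ 2) nP => B nP.
move=> /(ler_wpM2l d0); lra.
Qed.

Variables (Phi : H -> \bar R) (s : R).
Hypotheses (Phi_convex : econvex Phi) (Phi_lsc : lower_semicontinuous Phi)
  (Phi_proper : proper_function Phi) (s_gt0 : 0 < s) (sL : s * L <= 1).

Local Notation Theta := (fun z => Phi z + (Psi z)%:E)%E.

Lemma argmin_fin_num (xs : H) : argmin Theta xs -> Phi xs \is a fin_num.
Proof.
have [PhiNy [z0 z0fin]] := Phi_proper => /(_ z0).
case: (Phi xs) (PhiNy xs) => [| |]// _.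
by case: (Phi z0) z0fin.
Qed.

(** Fermat's rule: [- grad xs] is a subgradient of [Phi] at [xs]. The descent lemma supplies the
    upper expansion of [Psi]. *)
Lemma argmin_affine_minorant (xs z : H) : argmin Theta xs ->
  (Phi xs <= Phi z + (dot (grad xs) (z - xs))%:E)%E.
Proof.
move=> xsmin; apply: (first_order_condition (q := Psi)
  (B := L / 2 * `|z - xs| ^+ 2)) => //; first exact: argmin_fin_num.
move=> t t0 t1; apply: le_trans (descent_lemma xs _) _.
have -> : t *: z + (1 - t) *: xs - xs = t *: (z - xs).
  by rewrite scalerBl scale1r scalerBr -addrA [_ - xs]addrAC subrr add0r.
rewrite dotZr normrZ gtr0_norm//; lra.
Qed.

(** The quadratic absorbs the affine minorant of [Phi] at a minimizer. Writing the slope as [2 c e]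
    lets [c |z - x - e|^2] complete the square. *)
Lemma sqr_dist_lower_bound (c : R) (xs x : H) : 0 < c -> argmin Theta xs ->
  exists m : R, forall z, (m%:E <= Phi z + (c * `|z - x| ^+ 2)%:E)%E.
Proof.
move=> c0 xsmin; have := argmin_fin_num xsmin.
case PhiE : (Phi xs) => [r| |]// _.
have [e gradE] : exists e, grad xs = (2 * c) *: e.
  exists ((2 * c)^-1 *: grad xs).
  by rewrite scalerA mulfV ?scale1r// gt_eqF ?mulr_gt0.
exists (r - 2 * c * dot e (x - xs) - c * `|e| ^+ 2) => z.
have := argmin_affine_minorant z xsmin; rewrite PhiE gradE.
case: (Phi z) => [q| |]//; rewrite ?addye// ?leey// -!EFinD !lee_fin => rq.
have := mulr_ge0 (ltW c0) (dot_ge0 dot (z - x - e)).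
move: rq; rewrite !(sqr_normE hdot) !dotE.
rewrite (dotC dot z x) (dotC dot z e) (dotC dot x e); lra.
Qed.

(** Add the subgradient inequality of [prox] at [p], the gradient inequality from [y] to [z] and the
    descent lemma from [y] to [p]. *)
Lemma forward_backward_inequality (xs y g z : H) : argmin Theta xs ->
  let p := prox s Phi (y - s *: (grad y - g)) in
  Phi p \is a fin_num /\
  (Theta p <= Theta z +
     ((2 * s)^-1 * (`|y - z| ^+ 2 - `|p - z| ^+ 2) + dot g (p - z))%:E)%E.
Proof.
move=> xsmin p.
have c0 : 0 < (2 * s)^-1 by rewrite invr_gt0 mulr_gt0.
have [m mP] := sqr_dist_lower_bound (y - s *: (grad y - g)) c0 xsmin.
have [] := proxP hdot Phi_convex Phi_lsc Phi_proper s_gt0 mP.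
rewrite -/p => pfin /(_ z) pmin; split=> //; move: pmin pfin.
case: (Phi p) => [P| |]// + _.
case: (Phi z) => [Z| |]//; rewrite ?addye// ?leey// -!EFinD !lee_fin.
have -> : s^-1 * dot (p - (y - s *: (grad y - g))) (z - p) =
    2 * (2 * s)^-1 * dot (p - y) (z - p) + dot (grad y - g) (z - p).
  by rewrite !dotE; field; rewrite gt_eqF.
have := descent_lemma y p; have := gradient_inequality y z.
(* The step size condition [s L <= 1]: the error of the descent lemma is absorbed by the term
   [- (2 s)^-1 |p - y|^2] coming from [<p - y, z - p>]. *)
have : L / 2 * `|p - y| ^+ 2 <= (2 * s)^-1 * `|p - y| ^+ 2.
  rewrite ler_wpM2r// ?sqr_ge0// -(ler_pM2l (mulr_gt0 (ltr0n _ 2) s_gt0)).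
  rewrite mulfV; last by rewrite mulf_neq0// gt_eqF.
  by move: sL; lra.
rewrite !(sqr_normE hdot) !dotE; move: ((2 * s)^-1) => i.
rewrite (dotC dot z y) (dotC dot z p) (dotC dot p y); lra.
Qed.

End smooth_convex.

(** * Real sequences *)

Section real_sequences.
Context (R : realType).
Implicit Types (u v w e : nat -> R).

Lemma nneseries_partial_bound u : (forall k, 0 <= u k) ->
  (\sum_(0 <= k <oo) (u k)%:E < +oo)%E ->
  exists C, forall n, \sum_(0 <= k < n) u k <= C.
Proof.
move=> u0 fin; exists (fine (\sum_(0 <= k <oo) (u k)%:E)%E) => n.
have ge0 : (0 <= \sum_(0 <= k <oo) (u k)%:E)%E.
  by apply: nneseries_ge0 => k _ _; rewrite lee_fin.
rewrite -lee_fin fineK ?ge0_fin_numE// -sumEFin.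
by apply: nneseries_lim_ge => k _ _; rewrite lee_fin.
Qed.

Lemma nneseries_lty u (m : nat) (C : R) :
  (forall k, (m <= k)%N -> 0 <= u k) ->
  (forall n, \sum_(m <= k < n) u k <= C) ->
  (\sum_(m <= k <oo) (u k)%:E < +oo)%E.
Proof.
move=> u0 uC; apply: (@le_lt_trans _ _ C%:E); last by rewrite ltry.
apply: lime_le.
  by apply: is_cvg_nneseries => k mk _; rewrite lee_fin u0.
by apply: nearW => n; rewrite sumEFin lee_fin.
Qed.

Lemma descent_telescope u v w (C : R) : (forall n, 0 <= u n) ->
  (forall n, u n.+1 + v n <= u n + w n) ->
  (forall n, \sum_(0 <= k < n) w k <= C) ->
  forall n, \sum_(0 <= k < n) v k <= u 0 + C.
Proof.
move=> u0 uvw wC n.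
suff : u n + \sum_(0 <= k < n) v k <= u 0 + \sum_(0 <= k < n) w k.
  by move: (u0 n) (wC n); lra.
elim: n => [|n IH]; first by rewrite !big_geq.
rewrite !big_nat_recr//=; move: (uvw n) IH; lra.
Qed.

(** Subtracting the convergent partial sums of [w] makes [u] nonincreasing and bounded below by
    [- C]. *)
Lemma cvg_almost_nonincreasing u w (C : R) : (forall n, 0 <= u n) ->
  (forall n, 0 <= w n) -> (forall n, u n.+1 <= u n + w n) ->
  (forall n, \sum_(0 <= k < n) w k <= C) -> cvgn u.
Proof.
move=> u0 w0 uw wC; pose S n := \sum_(0 <= k < n) w k.
have cS : cvgn S.
  apply: nondecreasing_is_cvgn.
    by apply/nondecreasing_seqP => n; rewrite /S big_nat_recr//= lerDl.
  by exists C => _ [n _ <-]; exact: wC.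
have cuS : cvgn (fun n => u n - S n).
  apply: nonincreasing_is_cvgn.
    apply/nonincreasing_seqP => n; rewrite /S big_nat_recr//=.
    by have := uw n; lra.
  by exists (- C) => _ [n _ <-]; move: (u0 n) (wC n); rewrite /S; lra.
have -> : u = (fun n => (u n - S n) + S n) by apply/funext => n; rewrite subrK.
exact: is_cvgD.
Qed.

(** Were [l] positive, [u] would eventually exceed [l / 2], and the tail of the harmonic series
    would be at most [2 / l * C]. *)
Lemma cvg_harmonic_weighted u (l C : R) : (forall n, 0 <= u n) ->
  u @ \oo --> l -> (forall n, \sum_(0 <= k < n) u k / k.+1%:R <= C) -> l = 0.
Proof.
move=> u0 ul uC; apply/eqP/negP => /negP l0.
have {l0} l0 : 0 < l.
  rewrite lt_neqAle eq_sym l0/=.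
  have <- := cvg_lim (@Rhausdorff R) ul.
  by apply: limr_ge; [apply/cvg_ex; exists l | exact: nearW].
have l2 : l / 2 < l by lra.
have [N _ NP] := cvgr_gt l ul _ l2.
have h0 k : 0 <= k.+1%:R^-1 :> R by rewrite invr_ge0.
apply: (@dvg_harmonic R); apply: nondecreasing_is_cvgn.
  by apply/nondecreasing_seqP => n; rewrite /series/= big_nat_recr//= lerDl.
exists (\sum_(0 <= k < N) k.+1%:R^-1 + 2 / l * C) => _ [n _ <-].
rewrite /series/= /harmonic.
have -> : \sum_(0 <= k < N) k.+1%:R^-1 + 2 / l * C =
    \sum_(0 <= k < N + n) k.+1%:R^-1
    + (2 / l * C - \sum_(N <= k < N + n) k.+1%:R^-1).
  by rewrite (@big_cat_nat _ _ _ N 0 (N + n))//= ?leq_addr//; ring.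
have le1 : \sum_(0 <= k < n) k.+1%:R^-1 <= \sum_(0 <= k < N + n) k.+1%:R^-1 :> R.
  rewrite (@big_cat_nat _ _ _ n 0 (N + n))//= ?leq_addl// lerDl.
  by apply: sumr_ge0.
apply: le_trans le1 _; rewrite lerDl subr_ge0.
have l20 : 0 <= 2 / l by rewrite divr_ge0// ltW.
apply: le_trans (ler_wpM2l l20 (uC (N + n)%N)).
rewrite (@big_cat_nat _ _ _ N 0 (N + n))//= ?leq_addr// mulrDr.
rewrite -[leLHS]add0r lerD//.
  by rewrite mulr_ge0// sumr_ge0// => k _; rewrite mulr_ge0.
rewrite mulr_sumr ler_sum_nat// => k /andP[Nk _].
rewrite mulrA ler_peMl// mulrAC ler_pdivlMr// mul1r.
by have := NP k Nk; rewrite /=; lra.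
Qed.

(** A discrete Gronwall bound with implicit perturbation: [a^2 <= b^2 + c a] forces [a <= b + c] for
    nonnegative reals. *)
Lemma sqrt_gronwall u w (C : R) : (forall n, 0 <= u n) ->
  (forall n, 0 <= w n) ->
  (forall n, u n.+1 <= u n + w n * Num.sqrt (u n.+1)) ->
  (forall n, \sum_(0 <= k < n) w k <= C) ->
  forall n, Num.sqrt (u n) <= Num.sqrt (u 0) + C.
Proof.
move=> u0 w0 uw wC n.
suff : Num.sqrt (u n) <= Num.sqrt (u 0) + \sum_(0 <= k < n) w k.
  by move: (wC n); lra.
elim: n => [|n IH]; first by rewrite big_geq// addr0.
rewrite big_nat_recr//= addrA.
apply: (@le_trans _ _ (Num.sqrt (u n) + w n)); last by rewrite lerD2r.
have := uw n; rewrite -{1}(sqr_sqrtr (u0 n.+1)) -{1}(sqr_sqrtr (u0 n)).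
move: (sqrtr_ge0 (u n.+1)) (sqrtr_ge0 (u n)) (w0 n).
move: (Num.sqrt (u n.+1)) (Num.sqrt (u n)) (w n) => a b c a0 b0 c0 h.
rewrite leNgt; apply/negP => bca.
have : b * b <= b * (a - c) by apply: ler_wpM2l => //; lra.
have : b * (a - c) < a * (a - c) by rewrite ltr_pM2r; lra.
by move: h; rewrite !expr2; lra.
Qed.

End real_sequences.

(** * Energies of the inertial iteration *)

Section inertial_iteration.
Context (R : realType) (H : completeNormedModType R) (dot : {dot H for idfun}).
Hypothesis hdot : induces_norm dot.
Variables (x y g : nat -> H) (W : nat -> R) (xs : H) (a s C : R).
(* [W j] stands for [(Phi + Psi) (x j.+1) - min]: the shift avoids [x 0], where
   [Phi] may be infinite.  [a] is [alpha - 1]. *)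
Hypotheses (a_gt2 : 2 < a) (s_gt0 : 0 < s) (W_ge0 : forall j, 0 <= W j).
Hypothesis y_def : forall j,
  y j.+1 = x j.+1 + (j%:R / (j.+1%:R + a)) *: (x j.+1 - x j).
Hypothesis W_step : forall j (lam : R), 0 <= lam -> lam <= 1 ->
  let z := (1 - lam) *: x j.+1 + lam *: xs in
  2 * s * (W j.+1 - (1 - lam) * W j) <=
    `|y j.+1 - z| ^+ 2 - `|x j.+2 - z| ^+ 2 + 2 * s * dot (g j.+1) (x j.+2 - z).
Hypothesis g_sum : forall n, \sum_(0 <= k < n) k%:R * `|g k| <= C.

Let tau j : R := j%:R + a.
Let V j := a *: (x j - xs) + tau j *: (x j.+1 - x j).
Let E j := 2 * s * tau j ^+ 2 * W j + `|V j| ^+ 2.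
Let N j := tau j ^+ 2 * `|x j.+1 - x j| ^+ 2 + 2 * s * tau j ^+ 2 * W j.

(** * Decrease of the energy [E] and boundedness of the iterates *)

Let tauS j : tau j.+1 = tau j + 1.
Proof. by rewrite /tau -natr1 addrAC. Qed.

Let tau_ge j : a <= tau j.
Proof. by rewrite lerDr. Qed.

Let tau_gt0 j : 0 < tau j.
Proof. by move: (tau_ge j) a_gt2; lra. Qed.

Let a_gt0 : 0 < a. Proof. by move: a_gt2; lra. Qed.

Let energy_step j : E j.+1 + 2 * s * ((a - 2) * tau j * W j) <=
  E j + 2 * s * tau j.+1 * dot (g j.+1) (V j.+1).
Proof.
have t0 : tau j.+1 != 0 by rewrite gt_eqF.
(* With [lam = a / tau j.+1], both [y j.+1 - z] and [x j.+2 - z] become multiples of [V j] and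
   [V j.+1] by the same factor, so scaling by [tau j.+1 ^+ 2] telescopes. *)
have l0 : 0 <= a / tau j.+1 by rewrite divr_ge0// ltW.
have l1 : a / tau j.+1 <= 1 by rewrite ler_pdivrMr// mul1r.
have := W_step j l0 l1; rewrite /=.
set z := _ *: _ + _.
have -> : y j.+1 - z = (tau j.+1)^-1 *: V j.
  apply: (dot_eq hdot).
  have -> : y j.+1 = x j.+1 + ((tau j - a) / tau j.+1) *: (x j.+1 - x j).
    by rewrite y_def {1}/tau addrK.
  by rewrite /z /V !dotE; field.
have -> : x j.+2 - z = (tau j.+1)^-1 *: V j.+1.
  by apply: (dot_eq hdot); rewrite /z /V !dotE; field.
rewrite !normrZ dotZr !exprMn normfV gtr0_norm// => h.
have t2 : 0 <= tau j.+1 ^+ 2 by rewrite sqr_ge0.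
move: (ler_wpM2l t2 h).
have -> : tau j.+1 ^+ 2 * (2 * s * (W j.+1 - (1 - a / tau j.+1) * W j)) =
  2 * s * (tau j.+1 ^+ 2 * W j.+1 - (tau j.+1 ^+ 2 - a * tau j.+1) * W j) by field.
have -> : tau j.+1 ^+ 2 * ((tau j.+1)^-1 ^+ 2 * `|V j| ^+ 2 -
   (tau j.+1)^-1 ^+ 2 * `|V j.+1| ^+ 2 +
   2 * s * ((tau j.+1)^-1 * dot (g j.+1) (V j.+1))) =
   `|V j| ^+ 2 - `|V j.+1| ^+ 2 + 2 * s * tau j.+1 * dot (g j.+1) (V j.+1) by field.
have := mulr_ge0 (ltW s_gt0) (W_ge0 j); rewrite /E tauS => sW.
(* Since [tau j.+1 ^+ 2 - a tau j.+1 = tau j ^+ 2 - (a - 2) tau j - (a - 1)], the last term gives a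
   nonpositive contribution, which is dropped. *)
have : 0 <= (a - 1) * (s * W j) by rewrite mulr_ge0//; move: a_gt2; lra.
move: (`|V j| ^+ 2) (`|V j.+1| ^+ 2) (dot _ _) => v v' d; lra.
Qed.

Let perturbation_sum n : \sum_(0 <= j < n) tau j.+1 * `|g j.+1| <= (1 + a) * C.
Proof.
apply: (@le_trans _ _ ((1 + a) * \sum_(0 <= j < n) j.+1%:R * `|g j.+1|)).
  rewrite mulr_sumr ler_sum_nat// => j _; rewrite mulrA ler_wpM2r//.
  have : 0 <= a * j%:R by rewrite mulr_ge0// ltW.
  by rewrite /tau -natr1; lra.
rewrite ler_wpM2l//; first by move: a_gt0; lra.
by have := g_sum n.+1; rewrite big_nat_recl// mul0r add0r.
Qed.

Let E_ge0 j : 0 <= E j.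
Proof. by rewrite addr_ge0 ?sqr_ge0// !mulr_ge0 ?sqr_ge0// ltW. Qed.

Let N_ge0 j : 0 <= N j.
Proof. by rewrite addr_ge0// !mulr_ge0 ?sqr_ge0// ltW. Qed.

Let V_le_sqrtE j : `|V j| <= Num.sqrt (E j).
Proof.
rewrite -[leLHS]normr_id -sqrtr_sqr ler_wsqrtr// lerDr.
by rewrite !mulr_ge0 ?sqr_ge0// ltW.
Qed.

(** No bound on [V] is known yet, so the perturbation is estimated through [|V j| <= sqrt (E j)],
    which calls for the Gronwall bound. *)
Let V_bounded : exists2 M, 0 <= M & forall j, `|V j| <= M.
Proof.
exists (Num.sqrt (E 0) + 2 * s * ((1 + a) * C)).
  apply: addr_ge0; first exact: sqrtr_ge0.
  have := perturbation_sum 0; rewrite big_geq// => h.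
  by rewrite mulr_ge0// mulr_ge0// ltW.
move=> j; apply: le_trans (V_le_sqrtE j) _.
have w0 n : 0 <= 2 * s * (tau n.+1 * `|g n.+1|).
  by rewrite mulr_ge0// ?mulr_ge0// ltW.
apply: (sqrt_gronwall (w := fun n => 2 * s * (tau n.+1 * `|g n.+1|))) => // n.
  have := energy_step n.
  have : 0 <= 2 * s * ((a - 2) * tau n * W n).
    by rewrite !mulr_ge0// ?ltW// subr_gt0.
  have : tau n.+1 * dot (g n.+1) (V n.+1) <=
      tau n.+1 * (`|g n.+1| * Num.sqrt (E n.+1)).
    apply: ler_wpM2l; [exact: ltW | apply: le_trans (dot_le hdot _ _) _].
    by rewrite ler_wpM2l.
  move=> /(ler_wpM2l (ltW s_gt0)); lra.
by rewrite -mulr_sumr ler_wpM2l// mulr_ge0// ltW.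
Qed.

(** [tau j (x j.+1 - xs) = V j + j (x j - xs)] makes [x j.+1 - xs] an average of [V j / a] and
    [x j - xs] with weights [a / tau j] and [j / tau j]. *)
Lemma inertial_bounded : exists B, forall j, `|x j - xs| <= B.
Proof.
have [M M0 VM] := V_bounded; exists (`|x 0 - xs| + M / a).
elim=> [|j IH]; first by rewrite lerDl divr_ge0// ltW.
rewrite -(ler_pM2l (tau_gt0 j)) -{1}[tau j]gtr0_norm// -normrZ.
have -> : tau j *: (x j.+1 - xs) = V j + j%:R *: (x j - xs).
  by apply: (dot_eq hdot); rewrite /V /tau !dotE; ring.
apply: le_trans (ler_normD _ _) _; rewrite normrZ ger0_norm//.
have := VM j; have := ler_wpM2l (ler0n R j) IH; rewrite /tau.
have : a * (M / a) = M by field; rewrite gt_eqF.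
have : 0 <= a * `|x 0 - xs| by rewrite mulr_ge0// ltW.
lra.
Qed.

Let velocity_bounded : exists B, forall j, tau j * `|x j.+1 - x j| <= B.
Proof.
have [M M0 VM] := V_bounded; have [B xB] := inertial_bounded.
exists (M + a * B) => j.
rewrite -[tau j]gtr0_norm// -normrZ.
have -> : tau j *: (x j.+1 - x j) = V j - a *: (x j - xs).
  by rewrite /V addrAC subrr add0r.
apply: le_trans (ler_normB _ _) _; rewrite lerD// normrZ gtr0_norm//.
by rewrite ler_wpM2l// ltW.
Qed.

Let value_bound : exists K, forall n, \sum_(0 <= j < n) tau j * W j <= K.
Proof.
have [M M0 VM] := V_bounded.
have h n : \sum_(0 <= j < n) 2 * s * ((a - 2) * tau j * W j) <=
    E 0 + 2 * s * M * ((1 + a) * C).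
  apply: (descent_telescope (w := fun j => 2 * s * M * (tau j.+1 * `|g j.+1|))
    E_ge0) => {}n.
    apply: le_trans (energy_step n) _; rewrite lerD2l.
    have : tau n.+1 * dot (g n.+1) (V n.+1) <= tau n.+1 * (`|g n.+1| * M).
      apply: ler_wpM2l; [exact: ltW | apply: le_trans (dot_le hdot _ _) _].
      by rewrite ler_wpM2l.
    by move=> /(ler_wpM2l (ltW s_gt0)); lra.
  by rewrite -mulr_sumr ler_wpM2l// mulr_ge0// mulr_ge0// ltW.
have c0 : 0 < 2 * s * (a - 2) by rewrite !mulr_gt0// subr_gt0.
exists ((2 * s * (a - 2))^-1 * (E 0 + 2 * s * M * ((1 + a) * C))) => n.
rewrite ler_pdivlMl// mulr_sumr; apply: le_trans (h n).
by rewrite le_eqVlt; apply/orP; left; apply/eqP/eq_bigr => j _; ring.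
Qed.

(** * The energy [N], summability and limits *)

Let momentum_step j : N j.+1 + a * ((2 * j%:R + a) * `|x j.+1 - x j| ^+ 2) <=
  N j + 2 * s * (2 * tau j + 1) * W j +
  2 * s * tau j.+1 ^+ 2 * dot (g j.+1) (x j.+2 - x j.+1).
Proof.
have t0 : tau j.+1 != 0 by rewrite gt_eqF.
have := W_step j (lexx 0) ler01; rewrite /= subr0 scale1r scale0r addr0 mul1r.
have -> : y j.+1 - x j.+1 = (tau j.+1)^-1 *: (j%:R *: (x j.+1 - x j)).
  by rewrite y_def addrAC subrr add0r scalerA mulrC.
rewrite !normrZ !exprMn normfV normr_nat (gtr0_norm (tau_gt0 _)) => h.
have t2 : 0 <= tau j.+1 ^+ 2 by rewrite sqr_ge0.
move: (ler_wpM2l t2 h).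
have -> : tau j.+1 ^+ 2 * ((tau j.+1)^-1 ^+ 2 * (j%:R ^+ 2 * `|x j.+1 - x j| ^+ 2) -
   `|x j.+2 - x j.+1| ^+ 2 + 2 * s * dot (g j.+1) (x j.+2 - x j.+1)) =
   j%:R ^+ 2 * `|x j.+1 - x j| ^+ 2 - tau j.+1 ^+ 2 * `|x j.+2 - x j.+1| ^+ 2
   + 2 * s * tau j.+1 ^+ 2 * dot (g j.+1) (x j.+2 - x j.+1) by field.
(* The coefficients are [a (2 j + a) = tau j ^+ 2 - j^2] and
   [2 tau j + 1 = tau j.+1 ^+ 2 - tau j ^+ 2]. *)
rewrite /N tauS /tau.
move: (`|_| ^+ 2) (`|_| ^+ 2) (dot _ _) => v v' d; lra.
Qed.

Let momentum_bound : exists2 w : nat -> R,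
  (forall j, 0 <= w j) /\ (exists K, forall n, \sum_(0 <= j < n) w j <= K) &
  forall j, N j.+1 + a * ((2 * j%:R + a) * `|x j.+1 - x j| ^+ 2) <= N j + w j.
Proof.
have [B xB] := velocity_bounded; have [K WK] := value_bound.
have B0 : 0 <= B by apply: le_trans (xB 0); rewrite mulr_ge0// ltW.
(* The 6 comes from [2 tau j + 1 <= 3 tau j]. The velocity bound [B] uses up one factor [tau j.+1]
   of the perturbation and leaves the other to [|g j.+1|]. *)
exists (fun j => 6 * s * (tau j * W j) + 2 * s * B * (tau j.+1 * `|g j.+1|)).
  split=> [j|]; first by rewrite addr_ge0// !mulr_ge0// ltW.
  exists (6 * s * K + 2 * s * B * ((1 + a) * C)) => n.
  rewrite big_split/= -!mulr_sumr lerD// ler_wpM2l//.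
    by rewrite mulr_ge0// ltW.
  by rewrite !mulr_ge0// ltW.
move=> j; apply: le_trans (momentum_step j) _; rewrite -addrA lerD2l lerD//.
  have : 0 <= 2 * s * ((tau j - 1) * W j).
    apply: mulr_ge0; first by rewrite mulr_ge0// ltW.
    by rewrite mulr_ge0//; move: (tau_ge j) a_gt2; lra.
  lra.
have -> : 2 * s * tau j.+1 ^+ 2 * dot (g j.+1) (x j.+2 - x j.+1) =
  2 * s * tau j.+1 * (tau j.+1 * dot (g j.+1) (x j.+2 - x j.+1)) by ring.
have -> : 2 * s * B * (tau j.+1 * `|g j.+1|) = 2 * s * tau j.+1 * (`|g j.+1| * B).
  by ring.
apply: ler_wpM2l; first by rewrite !mulr_ge0// ltW.
apply: (@le_trans _ _ (`|g j.+1| * (tau j.+1 * `|x j.+2 - x j.+1|))).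
  rewrite mulrCA; apply: ler_wpM2l; first exact: ltW.
  exact: dot_le.
by rewrite ler_wpM2l.
Qed.

Lemma inertial_value_sum :
  exists K, forall n, \sum_(0 <= j < n) j.+1%:R * W j <= K.
Proof.
have [K WK] := value_bound; exists K => n; apply: le_trans (WK n).
apply: ler_sum => j _; rewrite ler_wpM2r// -natr1 /tau lerD2l.
by move: a_gt2; lra.
Qed.

Lemma inertial_velocity_sum :
  exists K, forall n, \sum_(0 <= j < n) j%:R * `|x j.+1 - x j| ^+ 2 <= K.
Proof.
have [w [w0 [K wK]] Nw] := momentum_bound.
exists (a^-1 * (N 0 + K)) => n; rewrite ler_pdivlMl//.
apply: le_trans (descent_telescope N_ge0 Nw wK n).
rewrite mulr_sumr; apply: ler_sum => j _; rewrite ler_pM2l// ler_wpM2r ?sqr_ge0//.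
by have := ler0n R j; move: a_gt2; lra.
Qed.

Let momentum_cvg0 : N @ \oo --> 0.
Proof.
have [w [w0 [K wK]] Nw] := momentum_bound.
have [K1 WK1] := value_bound.
have cN : cvgn N.
  apply: (cvg_almost_nonincreasing N_ge0 w0 _ wK) => n; apply: le_trans (Nw n).
  by rewrite lerDl !mulr_ge0 ?sqr_ge0 ?addr_ge0 ?mulr_ge0// ltW.
have /cvg_ex[l Nl] := cN.
suff l0 : l = 0 by rewrite -l0.
(* As [tau j <= a (j + 1)] and [tau j <= 2 j + a], the quotient [N j / (j + 1)] is at most [a ((2 j
   + a) |x j.+1 - x j|^2 + 2 s tau j W j)]; both parts have bounded sums. *)
apply: (cvg_harmonic_weighted (C := a * (a^-1 * (N 0 + K) + 2 * s * K1)) N_ge0 Nl) => n.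
have h1 := descent_telescope N_ge0 Nw wK n.
apply: (@le_trans _ _ (a * (\sum_(0 <= j < n) ((2 * j%:R + a) * `|x j.+1 - x j| ^+ 2)
   + 2 * s * \sum_(0 <= j < n) tau j * W j))).
  rewrite mulr_sumr -big_split/= mulr_sumr; apply: ler_sum => j _.
  rewrite ler_pdivrMr//.
  have t1 : tau j <= a * j.+1%:R.
    have : 0 <= (a - 1) * j%:R by rewrite mulr_ge0//; move: a_gt2; lra.
    by rewrite /tau -natr1; lra.
  have q0 : 0 <= tau j * (`|x j.+1 - x j| ^+ 2 + 2 * s * W j).
    by rewrite mulr_ge0 ?addr_ge0 ?sqr_ge0 ?mulr_ge0// ltW.
  have := ler_wpM2r q0 t1.
  have : 0 <= a * j.+1%:R * (j%:R * `|x j.+1 - x j| ^+ 2).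
    by rewrite !mulr_ge0 ?sqr_ge0// ltW.
  rewrite /N /tau; move: (j.+1%:R : R) => J; lra.
rewrite ler_pM2l//; apply: lerD.
  by rewrite ler_pdivlMl// mulr_sumr.
by rewrite ler_wpM2l// mulr_ge0// ltW.
Qed.

Lemma inertial_value_cvg0 : W @ \oo --> 0.
Proof.
have c0 : 0 < 2 * s * a ^+ 2 by rewrite !mulr_gt0 ?exprn_gt0.
have cN : (2 * s * a ^+ 2)^-1 * N j @[j --> \oo] --> 0.
  rewrite -[X in _ --> X](mulr0 (2 * s * a ^+ 2)^-1).
  by apply: cvgMr; exact: momentum_cvg0.
apply: (squeeze_cvgr _ (cvg_cst 0) cN); apply: nearW => j.
rewrite W_ge0/= ler_pdivlMl// /N.
have : 2 * s * W j * a ^+ 2 <= 2 * s * W j * tau j ^+ 2.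
  apply: ler_wpM2l; first by rewrite !mulr_ge0// ltW.
  by rewrite ler_pXn2r// nnegrE ltW.
have : 0 <= tau j ^+ 2 * `|x j.+1 - x j| ^+ 2 by rewrite mulr_ge0 ?sqr_ge0.
lra.
Qed.

Lemma inertial_dist_cvg : cvgn (fun j => `|x j - xs|).
Proof.
have [M M0 VM] := V_bounded.
have cE : cvgn E.
  apply: (@cvg_almost_nonincreasing _ _
    (fun j => 2 * s * M * (tau j.+1 * `|g j.+1|)) (2 * s * M * ((1 + a) * C))).
  - exact: E_ge0.
  - by move=> n; rewrite !mulr_ge0// ltW.
  - move=> n; have := energy_step n.
    have : 0 <= 2 * s * ((a - 2) * tau n * W n).
      by rewrite !mulr_ge0// ?ltW// subr_gt0.
    have : tau n.+1 * dot (g n.+1) (V n.+1) <= tau n.+1 * (`|g n.+1| * M).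
      apply: ler_wpM2l; [exact: ltW | apply: le_trans (dot_le hdot _ _) _].
      by rewrite ler_wpM2l.
    by move=> /(ler_wpM2l (ltW s_gt0)); lra.
  - by move=> n; rewrite -mulr_sumr ler_wpM2l// !mulr_ge0// ltW.
have /cvg_ex[l El] := cE.
have cW : 2 * s * tau j ^+ 2 * W j @[j --> \oo] --> 0.
  apply: (squeeze_cvgr _ (cvg_cst 0) momentum_cvg0); apply: nearW => j.
  rewrite lerDr !mulr_ge0 ?sqr_ge0//; exact: ltW.
have cV2 : `|V j| ^+ 2 @[j --> \oo] --> l.
  rewrite -[l]subr0.
  have -> : (fun j => `|V j| ^+ 2) = E - (fun j => 2 * s * tau j ^+ 2 * W j).
    by apply/funext => j; rewrite !fctE /E addrAC subrr add0r.
  exact: cvgB.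
have cV : `|V j| @[j --> \oo] --> Num.sqrt l.
  have -> : (fun j => `|V j|) = (fun j => Num.sqrt (`|V j| ^+ 2)).
    by apply/funext => j; rewrite sqrtr_sqr normr_id.
  apply: continuous_cvg => //; exact: sqrt_continuous.
have cD : `|tau j *: (x j.+1 - x j)| @[j --> \oo] --> 0.
  rewrite -(@sqrtr0 R).
  have : Num.sqrt (N j) @[j --> \oo] --> Num.sqrt 0.
    by apply: continuous_cvg; [exact: sqrt_continuous | exact: momentum_cvg0].
  move=> cS; rewrite sqrtr0 in cS *.
  apply: (squeeze_cvgr _ (cvg_cst 0) cS); apply: nearW => j.
  rewrite normr_ge0/= -[leLHS]normr_id -sqrtr_sqr ler_wsqrtr//.
  rewrite normrZ exprMn real_normK ?num_real// lerDl.
  by rewrite !mulr_ge0 ?sqr_ge0// ltW.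
have cax : `|a *: (x j - xs)| @[j --> \oo] --> Num.sqrt l.
  apply: (@squeeze_cvgr _ _ _ _ (fun j => `|V j| - `|tau j *: (x j.+1 - x j)|)
    (fun j => `|V j| + `|tau j *: (x j.+1 - x j)|)).
  - apply: nearW => j.
    have -> : a *: (x j - xs) = V j - tau j *: (x j.+1 - x j) by rewrite /V addrK.
    by rewrite ler_normB lerB_dist.
  - by rewrite -[X in _ --> X]subr0; apply: cvgB.
  - by rewrite -[X in _ --> X]addr0; apply: cvgD.
apply/cvg_ex; exists (a^-1 * Num.sqrt l).
have -> : (fun j => `|x j - xs|) = (fun j => a^-1 * `|a *: (x j - xs)|).
  apply/funext => j; rewrite normrZ gtr0_norm// mulrA mulVf ?mul1r//.
  by rewrite gt_eqF.
exact: cvgMr.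
Qed.

End inertial_iteration.

(** * Weak convergence *)

(** Compactness of [[-B, B]] gives a cluster point, and an ultrafilter converges to each of its
    cluster points. *)
Lemma ultra_cvg_bounded (R : realType) (T : Type) (U : set_system T)
    (f : T -> R) (B : R) : UltraFilter U -> (forall n, `|f n| <= B) ->
  exists l : R, f n @[n --> U] --> l.
Proof.
move=> UU fB.
have fI : fmap f U [set` `[- B, B]].
  by rewrite /fmap/=; apply: filterE => n; rewrite /= in_itv/= -ler_norml.
have [l [_ lU]] := segment_compact _ fI; exists l => A lA.
have [//|UA] := in_ultra_setVsetC (f @^-1` A) UU.
by have [z [nAz /nAz]] := lU (~` A) A UA lA.
Qed.

Section opial.
Context (R : realType) (H : completeNormedModType R) (dot : {dot H for idfun}).
Hypothesis hdot : induces_norm dot.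

(** The scalar limits along [U] depend linearly and boundedly on [h], so Riesz represents them by a
    vector; this plays the role of weak compactness of balls. *)
Lemma ultra_weak_limit (T : Type) (U : set_system T) (u : T -> H) (B : R) :
  UltraFilter U -> (forall n, `|u n| <= B) ->
  exists v, forall h, dot (u n) h @[n --> U] --> dot v h.
Proof.
move=> UU uB.
have uhB h n : `|dot (u n) h| <= B * `|h|.
  by apply: le_trans (normr_dot_le hdot _ _) _; rewrite ler_wpM2r.
have /choice[phi phiP] h := ultra_cvg_bounded UU (uhB h).
have phi_lin : linear (phi : H -> R^o).
  move=> k h1 h2; apply: (@cvg_unique _ (@Rhausdorff R) _ _ _ _ (phiP _)).
  have -> : (fun n => dot (u n) (k *: h1 + h2)) =
      (fun n => k * dot (u n) h1 + dot (u n) h2).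
    by apply/funext => n; rewrite dotDr dotZr.
  by apply: cvgD (phiP h2); apply: cvgMr; exact: phiP.
pose phil : {linear H -> R^o} :=
  HB.pack phi (GRing.isLinear.Build R H R^o *:%R phi phi_lin).
have phi_cont : continuous phil.
  apply: bounded_linear_continuous; apply/linear_boundedP.
  exists B; split; first exact: num_real.
  move=> r Br h; apply: (@le_trans _ _ (B * `|h|)); last by rewrite ler_wpM2r// ltW.
  have <- := cvg_lim (@Rhausdorff R) (cvg_norm (phiP h)).
  apply: limr_le; last exact: filterE.
  by apply/cvg_ex; exists `|phi h|; exact: cvg_norm.
have [v vP] := riesz hdot phi_cont.
by exists v => h; rewrite -vP; exact: phiP.
Qed.

(* Testing with [v1 - v2] shows that two weak limits in [S] coincide, since
   [2 <u_n, v1 - v2>] is, up to a constant, [|u_n - v2|^2 - |u_n - v1|^2]. *)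
Lemma opial (u : nat -> H) (S : set H) (B : R) : (forall n, `|u n| <= B) ->
  (forall z, S z -> cvgn (fun n => `|u n - z|)) ->
  (forall (U : set_system nat) v, UltraFilter U -> \oo `<=` U ->
     (forall h, dot (u n) h @[n --> U] --> dot v h) -> S v) ->
  exists2 v, S v & weakly_cvg u v.
Proof.
move=> uB uS US.
have unique (U1 U2 : set_system nat) v1 v2 :
    UltraFilter U1 -> UltraFilter U2 -> \oo `<=` U1 -> \oo `<=` U2 ->
    (forall h, dot (u n) h @[n --> U1] --> dot v1 h) ->
    (forall h, dot (u n) h @[n --> U2] --> dot v2 h) -> v1 = v2.
  move=> UU1 UU2 oU1 oU2 uv1 uv2.
  have /cvg_ex[l1 ul1] := uS _ (US _ _ UU1 oU1 uv1).
  have /cvg_ex[l2 ul2] := uS _ (US _ _ UU2 oU2 uv2).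
  pose c := 2^-1 * (l2 ^+ 2 - l1 ^+ 2 + (dot v1 v1 - dot v2 v2)).
  have uc : dot (u n) (v1 - v2) @[n --> \oo] --> c.
    have -> : (fun n => dot (u n) (v1 - v2)) = (fun n => 2^-1 *
        (`|u n - v2| ^+ 2 - `|u n - v1| ^+ 2 + (dot v1 v1 - dot v2 v2))).
      apply/funext => n; rewrite !(sqr_normE hdot) !dotE.
      by rewrite (dotC dot v1 (u n)) (dotC dot v2 (u n)); field.
    apply: cvgMr; apply: cvgD; last exact: cvg_cst.
    by apply: cvgB; exact: cvgM.
  have e1 : dot v1 (v1 - v2) = c.
    apply: (@cvg_unique _ (@Rhausdorff R) _ _ _ _ (uv1 _)).
    exact: cvg_trans (cvg_app _ oU1) uc.
  have e2 : dot v2 (v1 - v2) = c.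
    apply: (@cvg_unique _ (@Rhausdorff R) _ _ _ _ (uv2 _)).
    exact: cvg_trans (cvg_app _ oU2) uc.
  by apply: (dot_eq hdot); rewrite dotDl dotNl e1 e2 subrr.
have [U0 [UU0 oU0]] := ultraFilterLemma (@eventually_filter).
have [v0 uv0] := ultra_weak_limit UU0 uB.
exists v0; first exact: US uv0.
move=> phi /(riesz hdot)[w phiw]; rewrite phiw.
apply/cvgrPdist_lt => e e0.
pose A := [set n | `|dot w v0 - phi (u n)| < e].
have [//|nA] := pselect (\oo A).
(* Otherwise some ultrafilter finer than [\oo] avoids [A]. *)
have FA : ProperFilter (within (~` A) \oo).
  apply: Build_ProperFilter => //; rewrite /within/= => F0; apply: nA.
  by apply: filterS F0 => n /contrapT.
have [U [UU AU]] := ultraFilterLemma FA.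
have oU : \oo `<=` U by move=> P oP; apply: AU; apply: filterS oP.
have [v uv] := ultra_weak_limit UU uB.
have vv0 := unique _ _ _ _ UU UU0 oU oU0 uv uv0.
have UA : U A.
  have /cvgrPdist_lt/(_ e e0) := uv w.
  by apply: filterS => n; rewrite /A/= phiw vv0 (dotC dot v0) (dotC dot (u n)).
have UcA : U (~` A) by apply: AU; rewrite /within/=; exact: nearW.
by have [n [An /(_ An)]] := filter_ex (filterI UA UcA).
Qed.

End opial.

(** * Convergence of the perturbed inertial forward-backward iteration *)

Theorem theorem5p2 (R : realType) (H : completeNormedModType R)
  (dot : {dot H for idfun}) (hdot : induces_norm dot)
  (Phi : H -> \bar R) (Phi_convex : econvex Phi)
  (Phi_lsc : lower_semicontinuous Phi) (Phi_proper : proper_function Phi)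
  (Psi : H -> R) (Psi_convex : convex_function [set: H] Psi)
  (Psi_diff : forall z : H, differentiable Psi z)
  (Psi_C1 : continuous (gradient dot Psi))
  (L : R) (L_gt0 : 0 < L) (Psi_lip : L.-lipschitz (gradient dot Psi))
  (argmin_neq0 : argmin (fun z => Phi z + (Psi z)%:E)%E !=set0)
  (alpha s : R) (alpha_gt3 : 3 < alpha) (s_gt0 : 0 < s) (s_ltL : s < 1 / L)
  (g : nat -> H) (hg : (\sum_(0 <= k <oo) (k%:R * `|g k|)%:E < +oo)%E)
  (xm1 : H) (x y : nat -> H)
  (hy : forall k : nat,
    y k = x k + ((k%:R - 1) / (k%:R + alpha - 1)) *: (x k - prev_term xm1 x k))
  (hx : forall k : nat,
    x k.+1 = prox s Phi (y k - s *: (gradient dot Psi (y k) - g k))) :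
  [/\ (\sum_(1 <= k <oo)
         k%:R%:E * ((Phi (x k) + (Psi (x k))%:E)
                    - ereal_inf [set Phi z + (Psi z)%:E | z in [set: H]])
       < +oo)%E,
      (\sum_(1 <= k <oo) (k%:R * `|x k.+1 - x k| ^+ 2)%:E < +oo)%E
    & exists2 xs : H,
        argmin (fun z => Phi z + (Psi z)%:E)%E xs & weakly_cvg x xs].
Proof.
pose Theta z := (Phi z + (Psi z)%:E)%E.
have sL : s * L <= 1 by rewrite -ler_pdivlMr// ltW.
have [x0 x0min] := argmin_neq0.
pose m := fine (Theta x0).
have Theta_min z : argmin Theta z -> Theta z = m%:E.
  move=> zmin; have -> : m%:E = Theta x0.
    by rewrite /m fineK// fin_numD (argmin_fin_num Phi_proper x0min).
  by apply/eqP; rewrite eq_le zmin x0min.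
have m_le z : (m%:E <= Theta z)%E by rewrite -(Theta_min x0 x0min); exact: x0min.
have cTheta : econvex Theta by exact: econvexD.
have fb k := forward_backward_inequality hdot Psi_convex Psi_diff Psi_lip
  Phi_convex Phi_lsc Phi_proper s_gt0 sL (y k) (g k) ^~ x0min.
pose W j := fine (Theta (x j.+1)) - m.
have Theta_x j : Theta (x j.+1) = (W j + m)%:E.
  by rewrite /W subrK fineK// fin_numD hx; have [-> _] := fb j 0.
have W_ge0 j : 0 <= W j.
  by have := m_le (x j.+1); rewrite Theta_x lee_fin; lra.
have a_gt2 : 2 < alpha - 1 by lra.
(* With [k = j.+1] the previous term is [x j], so [xm1] enters only through [y 0]. *)
have y_def j : y j.+1 = x j.+1 + (j%:R / (j.+1%:R + (alpha - 1))) *: (x j.+1 - x j).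
  by rewrite hy /= -natr1 addrK addrA.
have W_step xs (xsmin : argmin Theta xs) j (lam : R) : 0 <= lam -> lam <= 1 ->
  let z := (1 - lam) *: x j.+1 + lam *: xs in
  2 * s * (W j.+1 - (1 - lam) * W j) <=
    `|y j.+1 - z| ^+ 2 - `|x j.+2 - z| ^+ 2 + 2 * s * dot (g j.+1) (x j.+2 - z).
  move=> l0 l1 /=; set z := _ *: _ + _; have [_] := fb j.+1 z.
  rewrite -hx -!/(Theta _) Theta_x.
  have l0' : 0 <= 1 - lam by rewrite subr_ge0.
  have l1' : 1 - lam <= 1 by rewrite gerBl.
  have := econvexE (x j.+1) xs cTheta l0' l1'.
  rewrite subKr -/z Theta_x (Theta_min _ xsmin).
  case: (Theta z) (m_le z) => [r| |]// _; rewrite -!EFinM -!EFinD !lee_fin => h1 h2.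
  have {}h2 := le_trans h2 (lerD h1 (lexx _)).
  have s2 : 0 <= 2 * s by rewrite mulr_ge0// ltW.
  have := ler_wpM2l s2 h2.
  have -> A B : 2 * s * (A + ((2 * s)^-1 * (`|y j.+1 - z| ^+ 2 - `|x j.+2 - z| ^+ 2) + B)) =
    2 * s * A + (`|y j.+1 - z| ^+ 2 - `|x j.+2 - z| ^+ 2) + 2 * s * B.
    by field; rewrite gt_eqF.
  lra.
have [C g_sum] : exists C, forall n, \sum_(0 <= k < n) k%:R * `|g k| <= C.
  by apply: nneseries_partial_bound hg => k; rewrite mulr_ge0.
have infE : ereal_inf [set Phi z + (Psi z)%:E | z in [set: H]]%E = m%:E.
  apply/eqP; rewrite eq_le; apply/andP; split.
    by rewrite -(Theta_min _ x0min); apply: ereal_inf_lbound; exists x0.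
  by apply: le_ereal_inf_tmp => _ [z _ <-]; exact: m_le.
split.
- have [K WK] := inertial_value_sum hdot a_gt2 s_gt0 W_ge0 y_def (W_step _ x0min) g_sum.
  rewrite (eq_eseriesr (g := fun k => (k%:R * W k.-1)%:E)); last first.
    (* The rewriting also covers [k = 0], where [Phi (x 0)] may be [+oo]; the convention
       [0 * +oo = 0] settles it. *)
    move=> [|k] _; first by rewrite !mul0r mul0e.
    by rewrite infE -/(Theta _) Theta_x/= -EFinB addrK -EFinM.
  apply: (nneseries_lty (C := K)) => [k _|n]; first by rewrite mulr_ge0.
  by rewrite big_add1; exact: WK.
- have [K DK] := inertial_velocity_sum hdot a_gt2 s_gt0 W_ge0 y_def (W_step _ x0min) g_sum.
  apply: (nneseries_lty (C := K)) => [k _|n]; first by rewrite mulr_ge0 ?sqr_ge0.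
  apply: le_trans (DK n.+1).
  rewrite big_nat_recl// mul0r add0r big_add1.
  case: n => [|n]; first by rewrite !big_geq.
  by rewrite [leRHS]big_nat_recr//= lerDl mulr_ge0 ?sqr_ge0.
have [B xB] := inertial_bounded hdot a_gt2 s_gt0 W_ge0 y_def (W_step _ x0min) g_sum.
have W0 := inertial_value_cvg0 hdot a_gt2 s_gt0 W_ge0 y_def (W_step _ x0min) g_sum.
(* The shifted sequence is used because its objective values are all finite. *)
have := @opial _ _ _ hdot (fun n => x n.+1) (argmin Theta) (B + `|x0|).
case.
- move=> n; rewrite -[x n.+1](subrK x0); apply: le_trans (ler_normD _ _) _.
  by rewrite lerD2r.
- move=> z zmin.
  have /cvg_ex[l xl] := inertial_dist_cvg hdot a_gt2 s_gt0 W_ge0 y_def (W_step _ zmin) g_sum.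
  by apply/cvg_ex; exists l; rewrite (cvg_shiftS (fun n => `|x n - z|)).
- move=> U v UU oU xv.
  have lTheta : lower_semicontinuous Theta.
    by apply: lower_semicontinuousD => // z; exact: differentiable_continuous.
  have pTheta : proper_function Theta.
    split=> [z|]; last by exists x0; rewrite Theta_min// ltry.
    by apply/eqP => zE; have := m_le z; rewrite zE.
  have c0 : 0 < 2^-1 :> R by rewrite invr_gt0.
  have mq z : (m%:E <= Theta z + (2^-1 * `|z - v| ^+ 2)%:E)%E.
    by rewrite -[leLHS]adde0 leeD// lee_fin mulr_ge0// sqr_ge0.
  have [p /(argmin_sqr_dist hdot cTheta pTheta)[_ pP]] :=
    strongly_convex_min hdot cTheta lTheta pTheta c0 mq.
  (* In the limit along [U] this bounds [Theta p] by [m - |v - p|^2], while [m <= Theta p]; hence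
     [v = p] and [Theta v = m]. Weak lower semicontinuity is thereby bypassed. *)
  have pn n : (Theta p <= (W n + m + dot (x n.+1 - p) (p - v))%:E)%E.
    by have := pP (x n.+1); rewrite Theta_x mulfV// mul1r -EFinD dotC.
  have lim_pn : W n + m + dot (x n.+1 - p) (p - v) @[n --> U] -->
      0 + m + dot (v - p) (p - v).
    apply: cvgD.
      apply: cvgD; last exact: cvg_cst.
      exact: cvg_trans (cvg_app _ oU) W0.
    under [X in X @ _]eq_fun do rewrite dotDl.
    by rewrite dotDl; apply: cvgD; [exact: xv | exact: cvg_cst].
  have Theta_p : (Theta p <= (m + dot (v - p) (p - v))%:E)%E.
    have pfin : Theta p = (fine (Theta p))%:E.
      have := pn 0; have := m_le p.
      by case: (Theta p).
    rewrite pfin lee_fin -[m in leRHS]add0r.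
    rewrite -(cvg_lim (@Rhausdorff R) lim_pn).
    apply: limr_ge; first by apply/cvg_ex; eexists; exact: lim_pn.
    by apply: nearW => n; rewrite -lee_fin -pfin.
  have vp : v = p.
    apply: (dot_eq hdot); apply/eqP; rewrite eq_le dot_ge0 andbT.
    have := le_trans (m_le p) Theta_p; rewrite lee_fin.
    rewrite -(opprB v p) dotNr; lra.
  move=> z; rewrite vp; apply: le_trans (m_le z).
  by apply: le_trans Theta_p _; rewrite vp subrr linear0l addr0.
move=> xs xsmin xscvg; exists xs => // phi phic.
by have := xscvg phi phic; rewrite -(cvg_shiftS (fun n => phi (x n))).
Qed.
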